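(* Let $B$ be a singleton board with $n$ columns, padded with columns of height zero on the left so that $\xi_m(B)=\langle z_1,\ldots,z_n\rangle$ has only non-negative entries. For each integer $k$ let $v_k$ be the number of entries of $\xi_m(B)$ equal to $k$, and let $M$ be the greatest integer with $v_M\ne0$. Let $S$ be the set of non-negative multiples of $m$ strictly less than $M$. Let $i$ be the least non-negative integer such that either $v_i>1$, or both $v_i=1$ and $i$ is not a multiple of $m$. Then the $m$-level rook equivalence graph $G_m(B)$ is connected if and only if $v_s\ge2$ for all $s\in S$ with $s>i$.
   Context: Fix an integer $m>0$. A Ferrers board is given by a weakly increasing sequence of non-negative integers $B=(b_1,\ldots,b_n)$ of column heights (cells in column $i$, rows $1,\ldots,b_i$, of the first quadrant); prepending height-$0$ columns on the left does not change the board, and boards are compared with the same number of columns by such padding. The rows are partitioned into levels: level $t$ consists of rows $(t-1)m+1,\ldots,tm$. An $m$-level rook placement of $k$ rooks is a set of $k$ cells of $B$, no two in the same level or the same column; $r_{k,m}(B)$ is their number, and two boards are $m$-level rook equivalent if they have equal $r_{k,m}$ for all $k\ge0$. For an integer $o$, $\lfloor o\rfloor_m$ is the largest multiple of $m$ that is $\le o$. $B$ is singleton if for each $i<n$, $b_i-\lfloor b_i\rfloor_m\ne0$ implies $\lfloor b_i\rfloor_m<\lfloor b_{i+1}\rfloor_m$. The $m$-level root vector of $B$ is $\xi_m(B)=\langle 0-b_1,m-b_2,\ldots,m(n-1)-b_n\rangle$. The $m$-level rook equivalence graph $G_m(B)$ of a singleton board $B$ has as vertices all singleton boards $m$-level rook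 equivalent to $B$, and $\{B_1,B_2\}$ is an edge iff, written with the same number of columns, $B_1$ and $B_2$ differ in exactly two columns $i,j$, where $B_1$ has $k$ more cells than $B_2$ in column $i$ and $k$ fewer in column $j$, for some $k>0$. *)

(* Defs.v *)
From mathcomp Require Import all_boot all_order all_algebra.
From Stdlib Require Import Relations.
Set Implicit Arguments. Unset Strict Implicit. Unset Printing Implicit Defensive.

(* A Ferrers board is a weakly increasing sequence of column heights
   B = [:: b_1; ...; b_n] (0-based: column j has height nth 0 B j).
   Cells are pairs (column j, row r) with j < size B and r < nth 0 B j,
   rows counted from 0, so 0-based row r is row r+1 and lies in level
   r %/ m + 1. *)

Definition board (B : seq nat) : bool := sorted leq B.

Definition cells (B : seq nat) : seq (nat * nat) :=
  [seq (j, r) | j <- iota 0 (size B), r <- iota 0 (nth 0 B j)].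

Definition compat (m : nat) (c d : nat * nat) : bool :=
  (c.1 != d.1) && (c.2 %/ m != d.2 %/ m).

Definition rook (m k : nat) (B : seq nat) : nat :=
  #|[set A : {set 'I_(size (cells B))} |
      (#|A| == k) &&
      [forall x in A, forall y in A,
         (x != y) ==> compat m (nth (0,0) (cells B) x) (nth (0,0) (cells B) y)]]|.

Definition rook_equiv (m : nat) (B1 B2 : seq nat) : Prop :=
  forall k, rook m k B1 = rook m k B2.

Definition floorm (m o : nat) : nat := (o %/ m) * m.

Definition singleton (m : nat) (B : seq nat) : bool :=
  [forall j : 'I_(size B),
     (j.+1 < size B) ==>
     ((nth 0 B j - floorm m (nth 0 B j) != 0) ==>
      (floorm m (nth 0 B j) < floorm m (nth 0 B j.+1)))].

Definition xi (m : nat) (B : seq nat) : seq int :=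
  [seq (Posz (m * j) - Posz (nth 0 B j))%R | j <- iota 0 (size B)].

Definition pad (N : nat) (B : seq nat) : seq nat := nseq (N - size B) 0 ++ B.

(* canonical representative of a board up to left zero-padding:
   weakly increasing with no zero columns *)
Definition normal_board (B : seq nat) : bool := board B && all (fun x => 0 < x) B.

Definition adj (B1 B2 : seq nat) : Prop :=
  let N := maxn (size B1) (size B2) in
  let P1 := pad N B1 in let P2 := pad N B2 in
  exists i j k, [/\ i < N, j < N, i != j, 0 < k &
    [/\ nth 0 P1 i = nth 0 P2 i + k, nth 0 P2 j = nth 0 P1 j + k &
        forall l, l < N -> l != i -> l != j -> nth 0 P1 l = nth 0 P2 l]].

(* vertices of G_m(B): singleton boards m-level rook equivalent to B,
   each represented by its unique representative without zero columns *)
Definition vertex (m : nat) (B C : seq nat) : Prop :=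
  normal_board C /\ singleton m C /\ rook_equiv m C B.

Definition G_edge (m : nat) (B : seq nat) : relation (seq nat) :=
  fun C1 C2 => [/\ vertex m B C1, vertex m B C2 & adj C1 C2].

Definition G_connected (m : nat) (B : seq nat) : Prop :=
  forall C1 C2, vertex m B C1 -> vertex m B C2 ->
    clos_refl_trans (seq nat) (G_edge m B) C1 C2.

Definition vcount (m : nat) (B : seq nat) (k : nat) : nat :=
  count (fun z => z == Posz k) (xi m B).

(* M : greatest entry of xi_m(B) (entries assumed non-negative) *)
Definition Mmax (m : nat) (B : seq nat) : nat := \max_(z <- xi m B) `|z|%N.

Definition Pi (m : nat) (B : seq nat) (i : nat) : Prop :=
  1 < vcount m B i \/ (vcount m B i = 1 /\ ~~ (m %| i)).

(* Main.v *)
Require Import Defs.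
From Stdlib Require Import Relations Classical.
From mathcomp Require Import all_boot all_order all_algebra.
From mathcomp Require Import zify ring.
Set Implicit Arguments. Unset Strict Implicit. Unset Printing Implicit Defensive.

(* For a singleton board a rook always excludes exactly m cells of every later
   column, so sum_k r_k x(x-m)...(x-(n-k-1)m) = prod_j (x - z_j), and rook
   equivalence means that the root vectors are rearrangements of each other.
   A rearrangement z comes from a singleton board iff z_0 = 0 and z_(j+1) is at
   most the least multiple of m exceeding z_j; edges of the graph are exchanges
   of two entries.  Hence a value above a multiple s of m ("gate") can only be
   entered from s.

   If s is a gate below the maximum with v_s = 1, then everything before s is
   below s and the next entry is above s, which forces the position of s to be
   the same at both ends of an edge.  If moreover something extra lies below s,
   the increasing arrangement and the one starting with all gates have s at
   different positions, so the graph is disconnected.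

   Conversely, start from any arrangement and keep exchanging a smaller entry with
   a later larger one.  If each gate is repeated or has nothing extra below it,
   the only arrangement where no such exchange is admissible is the sequence of
   all gates followed by the remaining entries in decreasing order. *)

(** * Rook numbers of singleton boards *)

(** Placements are listed as sublists of [L]; unlike index sets they can be counted by recursion on
    the cells. *)
Fixpoint placements (m : nat) (L : seq (nat * nat)) : seq (seq (nat * nat)) :=
  if L is c :: L' then
    placements m L' ++ [seq c :: A | A <- placements m L' & all (compat m c) A]
  else [:: [::]].

Lemma count_placements_cons m c L Q :
  count Q (placements m (c :: L)) =
  count Q (placements m L) +
  count (fun A => all (compat m c) A && Q (c :: A)) (placements m L).
Proof.
rewrite /= count_cat count_map count_filter; congr (_ + _).
by apply: eq_count => A /=; rewrite andbC.
Qed.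

Lemma compatC m c d : compat m c d = compat m d c.
Proof. by rewrite /compat eq_sym (eq_sym (c.2 %/ m)). Qed.

(** Since [compat] is symmetric, a cell added last obeys the same recursion as one added first; the
    cells of a new column come last. *)
Lemma count_placements_rcons m c L Q :
  count Q (placements m (rcons L c)) =
  count Q (placements m L) +
  count (fun A => all (compat m c) A && Q (rcons A c)) (placements m L).
Proof.
elim: L Q => [|d L IH] Q; first by rewrite count_placements_cons.
rewrite rcons_cons !count_placements_cons !IH -!addnA; congr (_ + _).
rewrite addnCA; congr (_ + (_ + _)).
apply: eq_count => A /=.
rewrite all_rcons (compatC m c d).
by case: (compat m d c); case: (all _ _); case: (all _ _); rewrite ?andbF.
Qed.

Lemma card_set_ord_recl n (P : pred {set 'I_n.+1}) :
  #|[set A | P A]| =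
  #|[set A : {set 'I_n} | P [set lift ord0 x | x in A]]| +
  #|[set A : {set 'I_n} | P (ord0 |: [set lift ord0 x | x in A])]|.
Proof.
pose f (A : {set 'I_n}) := [set lift ord0 x | x in A].
have finj : injective f by apply: imset_inj; apply: lift_inj.
have f0 A : ord0 \notin f A.
  by apply/imsetP => -[x _ /eqP]; rewrite (negbTE (neq_lift _ _)).
have fK (A : {set 'I_n.+1}) : ord0 \notin A -> A = f [set x | lift ord0 x \in A].
  move=> h; apply/setP => x; apply/idP/imsetP => [xA|[y]].
    case: (unliftP ord0 x) => [y e|e]; last by rewrite -e xA in h.
    by exists y => //; rewrite inE -e.
  by rewrite inE => hy ->.
rewrite -(cardsID [set A : {set 'I_n.+1} | ord0 \notin A] [set A | P A]); congr (_ + _).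
  rewrite -(card_imset _ finj); congr #|pred_of_set _|.
  apply/setP => A; rewrite !inE; apply/andP/imsetP => [[PA nA]|[A']].
    by exists [set x | lift ord0 x \in A]; rewrite ?inE -/(f _) -?fK.
  by rewrite inE => h ->; split.
have ginj : injective (fun A => ord0 |: f A).
  move=> A A' /setP e; apply: finj; apply/setP => x; have := e x; rewrite !inE.
  case: eqP => [->|_ //]; by rewrite !(negbTE (f0 _)).
rewrite -(card_imset _ ginj); congr #|pred_of_set _|.
apply/setP => A; rewrite !inE negbK; apply/andP/imsetP => [[nA PA]|[A']].
  have e : A = ord0 |: f [set x | lift ord0 x \in A :\ ord0].
    by rewrite -fK ?setD1K // !inE eqxx.
  by exists [set x | lift ord0 x \in A :\ ord0]; rewrite // inE -/(f _) -e.
by rewrite inE => h ->; split=> //; rewrite setU11.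
Qed.

(** The predicate [p] is there for the induction: once the first cell is chosen, the cells it
    attacks are excluded by strengthening [p]. *)
Lemma card_compat_sets m L k (p : pred (nat * nat)) :
  #|[set A : {set 'I_(size L)} |
      [&& #|A| == k,
       [forall x in A, forall y in A,
         (x != y) ==> compat m (nth (0,0) L x) (nth (0,0) L y)] &
       [forall x in A, p (nth (0,0) L x)]]]|
  = count (fun A => (size A == k) && all p A) (placements m L).
Proof.
elim: L k p => [|c L IH] k p.
  rewrite /= addn0 andbT.
  rewrite (_ : [set _ | _] = if k == 0 then [set set0] else set0); last first.
    apply/setP => A; have -> : A = set0 by apply/setP => -[].
    rewrite !inE cards0 (eq_sym 0).
    rewrite (_ : [forall x in _, forall y in _, _]); last by apply/forall_inP => -[].
    rewrite (_ : [forall x in _, _]); last by apply/forall_inP => -[].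
    by case: eqP; rewrite ?inE ?eqxx.
  by rewrite eq_sym; case: eqP; rewrite ?cards1 ?cards0.
rewrite card_set_ord_recl count_placements_cons; congr (_ + _).
  rewrite -IH; congr #|pred_of_set _|; apply/setP => A; rewrite !inE.
  rewrite card_imset; last exact: lift_inj.
  congr [&& _, _ & _].
    apply/forall_inP/forall_inP => h x xA; apply/forall_inP => y yA.
      have /forall_inP := h _ (imset_f (lift ord0) xA).
      by move=> /(_ _ (imset_f (lift ord0) yA)); rewrite (inj_eq lift_inj).
    case/imsetP: xA => x' xA ->; case/imsetP: yA => y' yA ->.
    rewrite (inj_eq lift_inj) /=.
    by have /forall_inP := h _ xA; move/(_ _ yA).
  apply/forall_inP/forall_inP => h x xA.
    by have := h _ (imset_f (lift ord0) xA).
  by case/imsetP: xA => x' xA ->; exact: h _ xA.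
case: k => [|k].
  rewrite [RHS](@eq_count _ _ pred0); last by move=> A; rewrite /= andbF.
  rewrite count_pred0; apply/eqP; rewrite cards_eq0; apply/eqP/setP => A.
  by rewrite !inE cards_eq0; apply/negP => /andP[/eqP/setP/(_ ord0)]; rewrite !inE.
case pc : (p c); last first.
  rewrite [RHS](@eq_count _ _ pred0); last by move=> A; rewrite /= pc !andbF.
  rewrite count_pred0; apply/eqP; rewrite cards_eq0; apply/eqP/setP => A.
  rewrite !inE; apply/negP => /and3P[_ _ /forall_inP/(_ ord0 (setU11 _ _))].
  by rewrite /= pc.
rewrite (@eq_count _ _ (fun A => (size A == k) && all (predI p (compat m c)) A)); last first.
  by move=> A; rewrite /= pc all_predI eqSS /=; do 2?case: (all _ _); rewrite ?andbF ?andbT.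
rewrite -IH; congr #|pred_of_set _|; apply/setP => A; rewrite !inE.
have n0 : ord0 \notin [set lift ord0 x | x in A].
  by apply/imsetP => -[x _ /eqP]; rewrite (negbTE (neq_lift _ _)).
rewrite cardsU1 n0 card_imset; last exact: lift_inj.
rewrite add1n eqSS; case: eqP => //= _.
apply/andP/andP => -[/forall_inP h1 /forall_inP h2]; split.
- apply/forall_inP => x xA; apply/forall_inP => y yA.
  have /forall_inP := h1 _ (setU1r ord0 (imset_f (lift ord0) xA)).
  by move=> /(_ _ (setU1r ord0 (imset_f (lift ord0) yA))); rewrite (inj_eq lift_inj).
- apply/forall_inP => x xA; rewrite /=.
  have := h2 _ (setU1r ord0 (imset_f (lift ord0) xA)) => /= ->.
  have /forall_inP := h1 _ (setU11 ord0 _).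
  by move=> /(_ _ (setU1r ord0 (imset_f (lift ord0) xA))).
- apply/forall_inP => x xA; apply/forall_inP => y yA; apply/implyP.
  case/setU1P: xA => [->|/imsetP[x' xA ->]]; case/setU1P: yA => [->|/imsetP[y' yA ->]] => //.
  + by move=> _; have /andP[] := h2 _ yA.
  + by move=> _; rewrite compatC; have /andP[] := h2 _ xA.
  + rewrite (inj_eq lift_inj) => ne.
    by have /forall_inP/(_ _ yA)/implyP := h1 _ xA; apply.
- apply/forall_inP => x; case/setU1P => [->|/imsetP[x' xA ->]] //.
  by have /andP[] := h2 _ xA.
Qed.

Lemma rook_placements m k B :
  rook m k B = count (fun A => size A == k) (placements m (cells B)).
Proof.
rewrite (@eq_count _ _ (fun A => (size A == k) && all predT A)); last first.
  by move=> A; rewrite all_predT andbT.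
rewrite -card_compat_sets; congr #|pred_of_set _|; apply/setP => A; rewrite !inE.
by rewrite (_ : [forall x in A, predT _]) ?andbT //; apply/forall_inP.
Qed.

Lemma mem_placements m L A :
  A \in placements m L -> {subset A <= L} /\ pairwise (compat m) A.
Proof.
elim: L A => [|c L IH] A /=; first by rewrite inE => /eqP ->.
rewrite mem_cat => /orP[/IH[sAL ok]|/mapP[A']].
  by split=> // x /sAL xL; rewrite inE xL orbT.
rewrite mem_filter => /andP[ok /IH[sAL pw] ->]; split; last by rewrite /= ok pw.
by move=> x; rewrite !inE => /orP[->//|/sAL ->]; rewrite orbT.
Qed.

(** * Placements column by column *)

Definition column (n b : nat) : seq (nat * nat) := [seq (n, r) | r <- iota 0 b].

Lemma columnS n b : column n b.+1 = rcons (column n b) (n, b).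
Proof. by rewrite /column -addn1 iotaD map_cat /= cats1. Qed.

Lemma cells_rcons B b : cells (rcons B b) = cells B ++ column (size B) b.
Proof.
rewrite /cells size_rcons -addn1 iotaD map_cat flatten_cat /= cats0; congr (_ ++ _).
  congr flatten; apply/eq_in_map => j; rewrite mem_iota add0n /= => jB.
  by rewrite nth_rcons jB.
by rewrite nth_rcons ltnn eqxx.
Qed.

Lemma cells_col_lt B c : c \in cells B -> (c.1 < size B) && (c.2 < nth 0 B c.1).
Proof.
case/allpairsPdep => j [r [+ + ->]].
by rewrite !mem_iota !add0n /= => -> ->.
Qed.

Lemma count_placements_avoid_column m L n b (Q : pred (seq (nat * nat))) :
  (forall A, Q A -> all (fun c => c.1 != n) A) ->
  count Q (placements m (L ++ column n b)) = count Q (placements m L).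
Proof.
move=> hQ; elim: b => [|b IH]; first by rewrite cats0.
rewrite columnS -rcons_cat count_placements_rcons IH.
rewrite [X in _ + X](@eq_count _ _ pred0) ?count_pred0 ?addn0 // => A /=.
by apply/negP => /andP[_ /hQ]; rewrite all_rcons eqxx.
Qed.

(** A column holds at most one rook, and since [L] avoids column [n], a rook there conflicts with
    the others only through its level. *)
Lemma count_placements_column m L n b k :
  (forall c, c \in L -> c.1 != n) ->
  count (fun A => size A == k.+1) (placements m (L ++ column n b)) =
  count (fun A => size A == k.+1) (placements m L) +
  \sum_(r <- iota 0 b) count
    (fun A => (size A == k) && (r %/ m \notin [seq c.2 %/ m | c <- A]))
    (placements m L).
Proof.
move=> hL; elim: b => [|b IH]; first by rewrite cats0 big_nil addn0.
rewrite columnS -rcons_cat count_placements_rcons IH -addnA; congr (_ + _).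
rewrite -[b.+1]addn1 iotaD big_cat big_seq1 /= add0n; congr (_ + _).
rewrite count_placements_avoid_column; last first.
  by move=> A /andP[h _]; apply: sub_all h => c /andP[/=]; rewrite eq_sym.
apply: eq_in_count => A /mem_placements[sAL _]; rewrite size_rcons eqSS andbC.
congr (_ && _).
apply/allP/negP => [h /mapP[c cA e]|h c cA]; first by have := h _ cA; rewrite /compat /= e eqxx andbF.
rewrite /compat /= eq_sym (hL _ (sAL _ cA)); apply/negP => /eqP e.
by apply: h; apply/mapP; exists c.
Qed.

Lemma count_level m b t : 0 < m -> t.+1 * m <= b ->
  count (fun r => r %/ m == t) (iota 0 b) = m.
Proof.
move=> m0 tb.
(* The rows are cut into those below level [t], its [m] rows, and those above. *)
rewrite (_ : b = t * m + (m + (b - t.+1 * m))); last by rewrite mulSn in tb *; lia.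
rewrite 2!iotaD !count_cat add0n.
rewrite (@eq_in_count _ _ pred0) => [|r]; last first.
  rewrite mem_iota add0n => /= rt; apply/negbTE; rewrite neq_ltn ltn_divLR //.
  by rewrite rt.
rewrite count_pred0 add0n [X in _ + X](@eq_in_count _ _ pred0) => [|r]; last first.
  rewrite mem_iota => /andP[h _]; apply/negbTE; rewrite neq_ltn.
  by rewrite leq_divRL // mulSn addnC h orbT.
rewrite count_pred0 addn0 (@eq_in_count _ _ predT) ?count_predT ?size_iota // => r.
rewrite mem_iota => /andP[h1 h2]; apply/eqP/anti_leq.
by rewrite -ltnS ltn_divLR // leq_divRL // h1 mulSn addnC h2.
Qed.

(** Every listed level lies wholly within the [b] rows and removes exactly [m] of them; the additive
    form avoids truncated subtraction. *)
Lemma count_free_rows m b (ts : seq nat) : 0 < m -> uniq ts ->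
  (forall t, t \in ts -> t.+1 * m <= b) ->
  count (fun r => r %/ m \notin ts) (iota 0 b) + size ts * m = b.
Proof.
move=> m0; elim: ts => [|t ts IH] /=.
  by move=> _ _; rewrite mul0n addn0 count_predT size_iota.
move=> /andP[nt /IH{}IH] h.
have htb : t.+1 * m <= b by apply: h; rewrite mem_head.
have {}IH := IH (fun u hu => h u (@mem_behead _ (t :: ts) u hu)).
rewrite -[RHS]IH mulSn addnA; congr (_ + _).
rewrite -[X in _ + X](count_level m0 htb) -count_predUI.
rewrite [X in _ + X](@eq_count _ _ pred0) => [|r /=]; last first.
  by rewrite inE negb_or; case: eqP; rewrite ?andbF.
rewrite count_pred0 addn0; apply: eq_count => r /=; rewrite inE negb_or.
by case: eqP => [->|_]; rewrite ?nt ?orbF.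
Qed.

(** * Singleton steps and the recursion for rook numbers *)

Definition ceilm (m x : nat) : nat := (x + m.-1) %/ m * m.

(* Weak monotonicity and the singleton condition merged into one relation
   between consecutive columns. *)
Definition singleton_step (m x y : nat) : bool := ceilm m x <= y.

Lemma leq_ceilm m x : 0 < m -> x <= ceilm m x.
Proof.
move=> m0; rewrite /ceilm; have := divn_eq (x + m.-1) m.
by have := ltn_pmod (x + m.-1) m0; lia.
Qed.

Lemma leq_level_ceilm m r x : 0 < m -> r < x -> (r %/ m).+1 * m <= ceilm m x.
Proof.
move=> m0 rx; rewrite /ceilm leq_mul2r leq_divRL // mulSn; apply/orP; right.
by have := leq_trunc_div r m; lia.
Qed.

Lemma singleton_step_trans m : 0 < m -> transitive (singleton_step m).
Proof.
move=> m0 y x z; rewrite /singleton_step => xy yz.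
by apply: leq_trans xy _; apply: leq_trans yz; apply: leq_ceilm.
Qed.

Lemma rook0 m B : rook m 0 B = 1.
Proof.
rewrite rook_placements; elim: (cells B) => // c L IH.
rewrite count_placements_cons IH (@eq_count _ _ pred0) ?count_pred0 // => A /=.
by rewrite andbF.
Qed.

(** Every level occupied on [B] fits entirely into the last column, so [k] rooks exclude exactly
    [k * m] of its [b] cells. *)
Lemma rook_rcons m k B b : 0 < m -> sorted (singleton_step m) (rcons B b) ->
  rook m k.+1 (rcons B b) + rook m k B * (k * m) = rook m k.+1 B + rook m k B * b.
Proof.
move=> m0 sB; rewrite !rook_placements cells_rcons count_placements_column; last first.
  by move=> c /cells_col_lt/andP[h _]; rewrite neq_ltn h.
rewrite -addnA; congr (_ + _).
set s := placements _ _.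
rewrite (eq_bigr (fun r => \sum_(A <- s | size A == k)
     (r %/ m \notin [seq c.2 %/ m | c <- A] : nat))); last first.
  move=> r _; rewrite -sum1_count big_mkcondr; apply: eq_bigr => A _.
  by case: (_ \notin _).
rewrite exchange_big -sum1_count !big_distrl -big_split /=.
rewrite !(big_seq_cond (fun A => size A == k)); apply: eq_bigr => A /andP[As /eqP sA].
have [sAL pw] := mem_placements As.
rewrite !mul1n (_ : k * m = size [seq c.2 %/ m | c <- A] * m); last by rewrite size_map sA.
rewrite -[RHS](@count_free_rows m b [seq c.2 %/ m | c <- A]) //.
- rewrite -sum1_count [in RHS]big_mkcond; congr (_ + _).
- rewrite uniq_pairwise pairwise_map; apply: sub_pairwise pw => c d /andP[_ h] //.
- move=> t /mapP[c /sAL/cells_col_lt/andP[h1 h2] ->].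
  (* Transitivity compares the new column with every earlier one, so the whole level of each rook
     lies within height [b]. *)
  move: sB; rewrite (sorted_pairwise (singleton_step_trans m0)) pairwise_rcons.
  move=> /andP[/allP/(_ _ (mem_nth 0 h1)) h _]; apply: leq_trans h.
  exact: leq_level_ceilm.
Qed.

Lemma sorted_rconsW T (e : rel T) s x : sorted e (rcons s x) -> sorted e s.
Proof. by case: s => //= y s; rewrite rcons_path => /andP[]. Qed.

Lemma rook_gt_size m k B : 0 < m -> sorted (singleton_step m) B ->
  size B < k -> rook m k B = 0.
Proof.
move=> m0; elim/last_ind: B k => [|B b IH] [|k] // sB.
  by move=> _; rewrite rook_placements.
rewrite size_rcons ltnS => Bk; have := rook_rcons k m0 sB.
have {}IH := IH _ (sorted_rconsW sB).
by rewrite (IH k.+1) ?(IH k) // ?mul0n ?addn0 // ltnW.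
Qed.

Lemma cells_nseq p : cells (nseq p 0) = [::].
Proof.
elim: p => // p IH.
by rewrite (_ : nseq p.+1 0 = rcons (nseq p 0) 0) ?cells_rcons ?IH // -cats1 -(nseqD p 1) addn1.
Qed.

Lemma sorted_nseq_cat m p B : 0 < m -> sorted (singleton_step m) (nseq p 0 ++ B) =
  sorted (singleton_step m) B.
Proof.
move=> m0; elim: p => //= p <-.
by case: (nseq p 0 ++ B) => //= x s; rewrite /singleton_step /ceilm add0n divn_small ?prednK.
Qed.

Lemma rook_nseq_cat m k p B : 0 < m -> sorted (singleton_step m) B ->
  rook m k (nseq p 0 ++ B) = rook m k B.
Proof.
move=> m0; elim/last_ind: B k => [|B b IH] [|k] sB; rewrite ?rook0 //.
  by rewrite cats0 !rook_placements cells_nseq.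
have sB' := sorted_rconsW sB.
have := rook_rcons k m0 sB; have := @rook_rcons m k (nseq p 0 ++ B) b m0.
rewrite rcons_cat sorted_nseq_cat // => /(_ sB); rewrite !IH //; lia.
Qed.

Lemma rook_pad m k N B : 0 < m -> sorted (singleton_step m) B ->
  rook m k (pad N B) = rook m k B.
Proof. exact: rook_nseq_cat. Qed.

Lemma xi_rcons m B b :
  xi m (rcons B b) = rcons (xi m B) (Posz (m * size B) - Posz b)%R.
Proof.
rewrite /xi size_rcons -addn1 iotaD map_cat cats1 add0n /= nth_rcons ltnn eqxx.
by congr rcons; apply/eq_in_map => j; rewrite mem_iota => /= jB; rewrite nth_rcons jB.
Qed.

(** * Factorization of the rook polynomial *)

Section FallingFactorials.
Import GRing.Theory Num.Theory.
Local Open Scope ring_scope.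

Definition falling (m n : nat) : {poly rat} := \prod_(i < n) ('X - ((i * m)%N%:R)%:P).

Lemma fallingS m n : falling m n.+1 = falling m n * ('X - ((n * m)%N%:R)%:P).
Proof. by rewrite /falling big_ord_recr. Qed.

Lemma falling_horner m n x : (0 < m)%N ->
  ((falling m n).[((x * m)%N%:R)] == 0) = (x < n)%N.
Proof.
move=> m0; elim: n => [|n IH].
  by rewrite /falling big_ord0 hornerC oner_eq0.
rewrite fallingS hornerM mulf_eq0 IH hornerXsubC subr_eq0 eqr_nat eqn_pmul2r //.
by rewrite orbC ltnS [RHS]leq_eqVlt.
Qed.

(** At [j * m] the falling factorials of degree above [j] vanish and that of degree [j] does not, so
    the system is triangular. *)
Lemma falling_free m n (c : nat -> rat) : (0 < m)%N ->
  \sum_(j < n) c j *: falling m j = 0 -> forall j, (j < n)%N -> c j = 0.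
Proof.
move=> m0 e j; elim/ltn_ind: j => j IH jn.
move/(congr1 (horner^~ ((j * m)%N%:R))): e => /=.
rewrite horner_sum horner0 (bigD1 (Ordinal jn)) //= big1 ?addr0.
  by rewrite hornerZ => /eqP; rewrite mulf_eq0 falling_horner // ltnn orbF => /eqP.
move=> i /eqP ij; rewrite hornerZ.
have [ij'|ji|e] := ltngtP i j.
- by rewrite IH ?mul0r.
- by move: ji; rewrite -(falling_horner _ _ m0) => /eqP ->; rewrite mulr0.
- by case: ij; apply: val_inj.
Qed.

(** With [n] columns before the new one, [X - (n * m - b)] splits as
    [(X - (n - k) * m) + (b - k * m)]: the first summand extends the falling factorial, the second
    accounts for a rook in the new column. *)
Lemma rook_factorization m B : (0 < m)%N -> sorted (singleton_step m) B ->
  \sum_(k < (size B).+1) (rook m k B)%:R *: falling m (size B - k)%N =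
  \prod_(z <- xi m B) ('X - (z%:~R)%:P).
Proof.
move=> m0; elim/last_ind: B => [|B b IH] sB.
  by rewrite big_ord1 rook0 big_nil scale1r /falling big_ord0.
have sB' := sorted_rconsW sB; have {}IH := IH sB'.
have r0 : rook m (size B).+1 B = 0%N by apply: rook_gt_size.
rewrite size_rcons xi_rcons -(cats1 (xi m B)) big_cat big_seq1 -IH big_ord_recl rook0.
rewrite /= mulr_suml.
have -> : \sum_(i < (size B).+1) (rook m (lift ord0 i) (rcons B b))%:R *:
    falling m ((size B).+1 - lift ord0 i) =
  \sum_(i < (size B).+1) (rook m i.+1 B)%:R *: falling m (size B - i) +
  \sum_(i < (size B).+1) (rook m i B)%:R *:
    ((b%:R - (i * m)%N%:R) *: falling m (size B - i)) :> {poly rat}.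
  rewrite -big_split; apply: eq_bigr => i _; rewrite lift0 subSS /=.
  rewrite scalerA -scalerDl; congr (_ *: _).
  have /(congr1 (fun x : nat => x%:R : rat)) := rook_rcons i m0 sB.
  rewrite !natrD !natrM => e; apply: (@addIr _ ((rook m i B)%:R * (i%:R * m%:R))).
  by rewrite e; ring.
(* There are no placements of [size B + 1] rooks on [B], which closes the index shift. *)
rewrite addrA (_ : 1%:R *: _ + _ =
    \sum_(i < (size B).+1) (rook m i B)%:R *: falling m ((size B).+1 - i)); last first.
  rewrite big_ord_recr [in RHS]big_ord_recl /= r0 scale0r addr0 rook0.
  by congr (_ + _); apply: eq_bigr => i _; rewrite subSS.
rewrite -big_split; apply: eq_bigr => i _ /=.
have iB : (i <= size B)%N by rewrite -ltnS.
rewrite subSn // fallingS -scalerDr -scalerAl; congr (_ *: _).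
rewrite -mul_polyC [_%:P * falling _ _]mulrC -mulrDr; congr (_ * _).
rewrite -addrA; congr (_ + _); rewrite -polyCN -polyCN -polyCD; congr (_%:P).
rewrite rmorphB /= -!pmulrn [(m * _)%N]mulnC !natrM natrB //; ring.
Qed.

(** Equal rook numbers give equal products of linear factors, hence equal multisets of roots.
    Conversely the product determines each rook number up to [size B] by independence of the falling
    factorials, and the later ones vanish. *)
Lemma rook_equiv_perm_xi m B C : (0 < m)%N -> size B = size C ->
  sorted (singleton_step m) B -> sorted (singleton_step m) C ->
  rook_equiv m B C <-> perm_eq (xi m B) (xi m C).
Proof.
move=> m0 sBC sB sC; have eB := rook_factorization m0 sB.
have eC := rook_factorization m0 sC; split=> [e|p].
  apply: (perm_map_inj (@intr_inj rat)); apply: prod_XsubC_eq.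
  rewrite [LHS]big_map [RHS]big_map; apply: etrans (esym eB) (etrans _ eC).
  by rewrite sBC; apply: eq_bigr => k _; rewrite e.
move=> k; have [kB|kB] := ltnP (size B) k.
  by rewrite !rook_gt_size // -sBC.
have : \sum_(j < (size B).+1)
   ((rook m (size B - j) B)%:R - (rook m (size B - j) C)%:R) *: falling m j = 0 :> {poly rat}.
  rewrite (eq_bigr (fun j : 'I__ => (rook m (size B - j) B)%:R *: falling m j -
     (rook m (size B - j) C)%:R *: falling m j)); last first.
    by move=> j _; rewrite scalerBl.
  rewrite sumrB; apply/eqP; rewrite subr_eq0; apply/eqP.
  rewrite (perm_big _ p) -eC -sBC in eB.
  (* Reversal turns the sum indexed by degree into the sum indexed by the number of rooks. *)
  rewrite (reindex_inj rev_ord_inj) [RHS](reindex_inj rev_ord_inj) /=.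
  have h (D : seq nat) : \sum_(j < (size B).+1)
      (rook m (size B - ((size B).+1 - j.+1)) D)%:R *: falling m ((size B).+1 - j.+1) =
      \sum_(j < (size B).+1) (rook m j D)%:R *: falling m (size B - j) :> {poly rat}.
    by apply: eq_bigr => j _; rewrite subSS subKn // -ltnS.
  by rewrite !h.
move/(@falling_free m _ (fun j => (rook m (size B - j) B)%:R - (rook m (size B - j) C)%:R)).
move=> /(_ m0 (size B - k)%N); rewrite subKn // ltnS leq_subr => /(_ isT)/eqP.
by rewrite subr_eq0 eqr_nat => /eqP.
Qed.

End FallingFactorials.

(** * Arrangements of the root vector *)

Local Notation "z `_ j" := (nth 0 z j) : nat_scope.

Lemma count_mem_ord (T : eqType) (x0 x : T) s :
  count_mem x s = #|[pred i : 'I_(size s) | nth x0 s i == x]|.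
Proof. by rewrite -sum1_count (big_nth x0) big_mkord sum1_card. Qed.

Lemma count_mem_le1_inj (T : eqType) (x0 x : T) s i j : count_mem x s <= 1 ->
  i < size s -> j < size s -> nth x0 s i = x -> nth x0 s j = x -> i = j.
Proof.
rewrite (count_mem_ord x0) => /card_le1_eqP h il jl ei ej.
have := h (Ordinal jl) (Ordinal il); rewrite !inE /= ej ei eqxx.
by move=> /(_ isT isT)/(congr1 val).
Qed.

Lemma count_mem_gt1_other (T : eqType) (x0 x : T) s j : 1 < count_mem x s ->
  exists i, [/\ i < size s, i != j & nth x0 s i = x].
Proof.
rewrite (count_mem_ord x0) => /card_gt1P[a [b [+ + ab]]].
rewrite !inE => /eqP ha /eqP hb.
have [e|ne] := eqVneq (val a) j; last by exists a.
exists b; split=> //; rewrite -e; apply: contraNneq ab => e'.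
by apply/eqP/val_inj.
Qed.

Lemma nondecreasing_nth s i j : sorted leq s -> i <= j -> j < size s ->
  nth 0 s i <= nth 0 s j.
Proof.
move=> srt ij js.
exact: (sorted_leq_nth leq_trans leqnn 0 srt i j (leq_ltn_trans ij js) js ij).
Qed.

Lemma nonincreasing_nth s i j : sorted geq s -> i <= j -> nth 0 s j <= nth 0 s i.
Proof.
move=> srt ij; have [js|js] := ltnP j (size s); last by rewrite nth_default.
have tr : transitive geq by move=> a b c ab bc; apply: leq_trans bc ab.
exact: (sorted_leq_nth tr leqnn 0 srt i j (leq_ltn_trans ij js) js ij).
Qed.

(** * Admissible arrangements and their gates *)

Definition step (m x : nat) : nat := (x %/ m).+1 * m.

(** This is what the singleton steps of a board become for its root vector, as [admissible_complP]
    shows. *)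
Definition admissible (m : nat) (z : seq nat) : Prop :=
  nth 0 z 0 = 0 /\
  forall j, j.+1 < size z -> nth 0 z j.+1 <= step m (nth 0 z j).

Lemma leq_step m x : 0 < m -> x < step m x.
Proof. exact: ltn_ceil. Qed.

Lemma step_mono m x y : x <= y -> step m x <= step m y.
Proof. by move=> xy; rewrite /step leq_mul2r ltnS leq_div2r ?orbT. Qed.

Lemma step_mul m t : 0 < m -> step m (t * m) = t.+1 * m.
Proof. by move=> m0; rewrite /step mulnK. Qed.

Lemma lt_step m t x : 0 < m -> (t * m < step m x) = (t * m <= x).
Proof. by move=> m0; rewrite /step ltn_pmul2r // ltnS leq_divRL. Qed.

Lemma step_le m t x : 0 < m -> (step m x <= t * m) = (x < t * m).
Proof. by move=> m0; rewrite leqNgt lt_step // ltnNge. Qed.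

Section Admissible.
Variables (m : nat) (z : seq nat).
Hypotheses (m0 : 0 < m) (az : admissible m z).

Lemma admissible_le j : j < size z -> z`_j <= j * m.
Proof.
case: az => z0 zS; elim: j => [|j IH] jz; first by rewrite z0.
apply: leq_trans (zS _ jz) _; rewrite step_le // mulSn.
by have := IH (ltnW jz); lia.
Qed.

(* A value above [t * m] can only be entered from [t * m] itself. *)
Lemma admissible_gate t j : j < size z -> t * m < z`_j ->
  exists p, [/\ p < j, z`_p = t * m, t * m < z`_p.+1 & forall q, q <= p -> z`_q <= t * m].
Proof.
case: az => z0 zS jz tj; have ex : exists q, t * m < z`_q by exists j.
case: (ex_minnP ex) => -[|p] tp hp; first by rewrite z0 in tp.
have pj := hp _ tj; have le q : q <= p -> z`_q <= t * m.
  by move=> qp; rewrite leqNgt; apply/negP => /hp; rewrite ltnNge qp.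
exists p; split=> //; apply/anti_leq; rewrite le //= -lt_step //.
by apply: leq_trans tp (zS _ (leq_ltn_trans pj jz)).
Qed.

Lemma admissible_mem t x : x \in z -> t * m < x -> t * m \in z.
Proof.
move=> /(nthP 0)[j jz <-] h; have [p [pj <- _ _]] := admissible_gate jz h.
by rewrite mem_nth // (ltn_trans pj).
Qed.

(** The crossing position found by [admissible_gate] carries the gate, so uniqueness makes it the
    index, and no earlier entry can equal the gate. *)
Lemma admissible_unique_gate t x : count_mem (t * m) z = 1 -> x \in z -> t * m < x ->
  let p := index (t * m) z in
  [/\ p.+1 < size z, t * m < z`_p.+1 & forall q, q < p -> z`_q < t * m].
Proof.
move=> t1 /(nthP 0)[j jz <-] h.
have [p [pj pt pS ple]] := admissible_gate jz h; have pz := ltn_trans pj jz.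
have -> : index (t * m) z = p.
  have tz : t * m \in z by rewrite -pt mem_nth.
  apply: (@count_mem_le1_inj _ 0 (t * m) z); rewrite ?t1 ?index_mem //.
  exact: nth_index.
split=> //=; first exact: leq_ltn_trans pj jz.
move=> q qp; rewrite ltn_neqAle ple 1?ltnW // andbT; apply/eqP => e.
have := @count_mem_le1_inj _ 0 (t * m) z q p; rewrite t1 => /(_ isT (ltn_trans qp pz) pz e pt).
by move=> e'; rewrite e' ltnn in qp.
Qed.

End Admissible.

(* If the gate sat further left in [z1], then [z1] would exceed [z2] both at the
   gate and at the next position. *)
Lemma index_unique_gate_edge m t z1 z2 i j x1 x2 : 0 < m ->
  admissible m z1 -> admissible m z2 -> size z1 = size z2 ->
  count_mem (t * m) z1 = 1 -> count_mem (t * m) z2 = 1 ->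
  x1 \in z1 -> t * m < x1 -> x2 \in z2 -> t * m < x2 ->
  z1`_i < z2`_i -> z2`_j < z1`_j ->
  (forall l, l < size z1 -> l != i -> l != j -> z1`_l = z2`_l) ->
  index (t * m) z1 = index (t * m) z2.
Proof.
move=> m0; move: z1 z2 i j x1 x2.
have H z1 z2 i j x1 x2 : admissible m z1 -> admissible m z2 -> size z1 = size z2 ->
  count_mem (t * m) z1 = 1 -> count_mem (t * m) z2 = 1 ->
  x1 \in z1 -> t * m < x1 -> x2 \in z2 -> t * m < x2 ->
  z1`_i < z2`_i -> z2`_j < z1`_j ->
  (forall l, l < size z1 -> l != i -> l != j -> z1`_l = z2`_l) ->
  index (t * m) z2 <= index (t * m) z1.
  move=> a1 a2 sz c1 c2 x1z tx1 x2z tx2 hi hj eqz; rewrite leqNgt; apply/negP => lt.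
  have [/= s1 g1 _] := admissible_unique_gate m0 a1 c1 x1z tx1.
  have [/= s2 g2 l2] := admissible_unique_gate m0 a2 c2 x2z tx2.
  have at1 : z1`_(index (t * m) z1) = t * m.
    by apply: nth_index; rewrite -has_pred1 has_count c1.
  have at2 : z2`_(index (t * m) z2) = t * m.
    by apply: nth_index; rewrite -has_pred1 has_count c2.
  (* Only position [j] may carry a larger entry in [z1], so two such positions are contradictory. *)
  have isj l : l < size z1 -> z2`_l < z1`_l -> l = j.
    move=> ls gt; apply/eqP/negPn/negP => lj.
    have [li|li] := eqVneq l i; first by move: hi; rewrite -li ltnNge ltnW.
    by move: gt; rewrite eqz ?ltnn.
  have e1 := isj _ (ltnW s1); rewrite at1 in e1; have {}e1 := e1 (l2 _ lt).
  have e2 : (index (t * m) z1).+1 = j.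
    apply: isj => //; apply: leq_ltn_trans g1.
    by move: lt; rewrite leq_eqVlt => /orP[/eqP->|/l2/ltnW//]; rewrite at2.
  by move: e2; rewrite -e1 => /eqP; rewrite eqn_leq ltnn.
move=> z1 z2 i j x1 x2 a1 a2 sz c1 c2 x1z tx1 x2z tx2 hi hj eqz; apply/anti_leq.
rewrite (H z1 z2 i j x1 x2) // andbT (H z2 z1 j i x2 x1) // => l lz li lj.
by rewrite eqz // sz.
Qed.

(** If a sorted entry jumped over the next multiple of [m], that multiple would occur in [z] by
    [admissible_mem], yet lie strictly between two consecutive sorted entries. *)
Lemma admissible_sort m z : 0 < m -> admissible m z -> admissible m (sort leq z).
Proof.
move=> m0 az; have srt := sort_sorted leq_total z.
have memz x : (x \in sort leq z) = (x \in z) by rewrite mem_sort.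
have [z0|/eqP zn] := eqVneq z [::]; first by rewrite z0.
have zs : 0 < size z by case: z zn {az srt memz}.
split.
  have : 0 \in sort leq z by rewrite memz -az.1 mem_nth.
  move=> /(nthP 0)[j jz e]; apply/eqP; rewrite -leqn0.
  have := nondecreasing_nth srt (leq0n j) jz.
  by rewrite e.
move=> j jz; rewrite leqNgt; apply/negP => h.
have memj : (sort leq z)`_j.+1 \in z by rewrite -memz mem_nth.
have := admissible_mem m0 az memj h; rewrite -memz => /(nthP 0)[k kz e].
have kj : k < j.+1.
  rewrite ltnNge; apply/negP => jk.
  have := nondecreasing_nth srt jk kz.
  by rewrite e -/(step _ _); move: h; rewrite /step; lia.
have := nondecreasing_nth srt (kj : k <= j) (ltnW jz).
by rewrite e -/(step _ _) leqNgt leq_step.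
Qed.

Definition gates (m e : nat) : seq nat := mkseq (fun j => j * m) e.

(** The witness lists the gates below the maximum in order and then the rest decreasingly. After the
    last gate any entry may follow, and a descent is always allowed. *)
Lemma admissible_gates_first m z : 0 < m -> admissible m z ->
  exists2 w, admissible m w /\ perm_eq w z &
    forall t x, x \in z -> t * m < x -> index (t * m) w = t.
Proof.
(* [e] is the number of multiples of [m] strictly below the maximum [M]. *)
move=> m0 az; pose M := \max_(x <- z) x; pose e := (M + m.-1) %/ m.
have geM x : x \in z -> x <= M by move=> xz; apply: leq_bigmax_seq.
have lte t : (t < e) = (t * m < M).
  by rewrite /e leq_divRL // mulSn; lia.
have uniqg : uniq (gates m e).
  rewrite map_inj_uniq ?iota_uniq // => a b /eqP.
  by rewrite eqn_pmul2r // => /eqP.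
have subz x : x \in gates m e -> x \in z.
  move=> /mapP[t]; rewrite mem_iota /= add0n lte => tM ->.
  have [z0|zn] := eqVneq z [::]; first by rewrite /M z0 big_nil in tM.
  have [y yz tz] : exists2 y, y \in z & t * m < y.
    apply/hasP; apply/negPn/negP => /hasPn h; move: tM; rewrite ltnNge => /negP; apply.
    by apply/bigmax_leqP_seq => y yz _; rewrite leqNgt h.
  exact: (admissible_mem m0 az yz tz).
have [s sub p] : exists2 s, subseq s z & perm_eq (gates m e) s.
  apply/count_subseqP => x; rewrite count_uniq_mem //; case: (boolP (x \in gates m e)) => //.
  by move=> /subz; rewrite -has_pred1 has_count.
have [r pr] := perm_to_subseq sub.
pose d := sort geq r.
have pw : perm_eq (gates m e ++ d) z.
  rewrite perm_sym; apply: perm_trans pr _; rewrite perm_sym.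
  by apply: perm_cat => //; rewrite perm_sort.
exists (gates m e ++ d); last first.
  move=> t x xz tx; have te : t < e by rewrite lte (leq_trans tx) ?geM.
  rewrite index_cat (_ : t * m \in _); last by apply/mapP; exists t; rewrite ?mem_iota.
  have {1}-> : t * m = nth 0 (gates m e) t by rewrite nth_mkseq.
  by rewrite index_uniq ?size_mkseq.
split=> //.
have nthg j : j < e -> (gates m e ++ d)`_j = j * m.
  by move=> je; rewrite nth_cat size_mkseq je nth_mkseq.
have nthd j : e <= j -> (gates m e ++ d)`_j = d`_(j - e).
  by move=> je; rewrite nth_cat size_mkseq ltnNge je.
have srt : sorted geq d by apply: sort_sorted => a b; apply: leq_total.
have led k : d`_k <= M.
  have [kd|kd] := ltnP k (size d); last by rewrite nth_default.
  by apply: geM; rewrite -(perm_mem pw) mem_cat mem_nth ?orbT.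
have eM : M <= e * m by rewrite leqNgt -lte ltnn.
split.
  (* Without a gate below [M] all entries are zero. *)
  have [e0|e0] := posnP e; last by rewrite nthg.
  by apply/eqP; rewrite nthd ?e0 // -leqn0 (leq_trans (led _)) // (leq_trans eM) // e0.
move=> j jz; have [je|ej] := ltnP j.+1 e.
  by rewrite !nthg ?step_mul // ltnW.
rewrite nthd //; have [je|je] := ltnP j e.
  rewrite nthg // step_mul // (leq_trans (led _)) // (leq_trans eM) //.
  by rewrite leq_mul2r ej orbT.
rewrite nthd // ltnW // (leq_ltn_trans _ (leq_step _ m0)) //.
by apply: nonincreasing_nth srt _; apply: leq_sub2r.
Qed.

(** * Exchanges of entries and terminal arrangements *)

Definition swap_index (j l t : nat) : nat :=
  if t == j then l else if t == l then j else t.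

Definition swap_at (j l : nat) (z : seq nat) : seq nat :=
  mkseq (fun t => z`_(swap_index j l t)) (size z).

Lemma swap_indexK j l : involutive (swap_index j l).
Proof.
move=> t; rewrite /swap_index.
have [->|tj] := eqVneq t j; first by rewrite eqxx; case: eqP.
have [->|tl] := eqVneq t l; first by rewrite eqxx.
by rewrite (negbTE tj) (negbTE tl).
Qed.

Lemma perm_swap_at j l z : j < size z -> l < size z -> perm_eq (swap_at j l z) z.
Proof.
move=> jz lz; rewrite /swap_at /mkseq (map_comp (nth 0 z)).
rewrite -[X in perm_eq _ X](mkseq_nth 0) /mkseq; apply: perm_map.
apply: uniq_perm; rewrite ?iota_uniq //.
  by rewrite map_inj_uniq ?iota_uniq //; apply: inv_inj (swap_indexK j l).
have sub t : t < size z -> swap_index j l t < size z.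
  by rewrite /swap_index; case: eqP => // _; case: eqP.
move=> t; rewrite mem_iota add0n; apply/mapP/idP => [[u]|tz].
  by rewrite mem_iota add0n => /= uz ->; apply: sub.
by exists (swap_index j l t); rewrite ?swap_indexK // mem_iota add0n sub.
Qed.

(** The larger entry loosens the bound on its successor, and the smaller one satisfies the bound
    from its predecessor more easily. The last two hypotheses cover the entry into [j.+1] and the
    exit from [l]. *)
Lemma admissible_swap_at m z j l : 0 < m -> admissible m z ->
  j.+1 < l -> l < size z -> z`_j.+1 < z`_l -> z`_l <= step m z`_j ->
  (l.+1 < size z -> z`_l.+1 <= step m z`_j.+1) ->
  admissible m (swap_at j.+1 l z).
Proof.
move=> m0 [z0 zS] jl1 lz lt le nxt; have jl := ltnW jl1; split.
  by rewrite nth_mkseq ?(leq_ltn_trans _ lz) // /swap_index /=; case: l jl {lz lt le jl1 nxt}.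
move=> t; rewrite size_mkseq => tz; rewrite !nth_mkseq ?(ltnW tz) // /swap_index.
have tz' := zS _ tz.
rewrite eqSS; have [->|tj] := eqVneq t j.
  by rewrite (ltn_eqF (ltnSn j)) (ltn_eqF jl).
have [e|tj1] := eqVneq t j.+1.
  rewrite e in tz tz' *; have [e'|_] := eqVneq j.+2 l.
    by apply: ltnW; apply: leq_trans lt _; apply: ltnW; apply: leq_step.
  by apply: leq_trans tz' _; apply: step_mono; apply: ltnW.
have [e|_] := eqVneq t.+1 l.
  rewrite -{1}e (ltn_eqF (ltnSn t)).
  by apply: ltnW; apply: leq_trans lt _; rewrite -e.
have [e|//] := eqVneq t l.
by rewrite e; apply: nxt; rewrite -e.
Qed.

(** Earlier positions count more, so moving a larger entry to the left raises this measure; its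
    bound makes improving exchanges terminate. *)
Definition weight (z : seq nat) : nat := \sum_(t < size z) (size z - t) * z`_t.

Lemma weight_swap_at z j l : j < l -> l < size z -> z`_j < z`_l ->
  weight z < weight (swap_at j l z).
Proof.
move=> jl lz lt; have jz := ltn_trans jl lz.
rewrite /weight size_mkseq.
have lj : Ordinal lz != Ordinal jz by rewrite -val_eqE /= gtn_eqF.
rewrite (bigD1 (Ordinal jz)) // (bigD1 (Ordinal lz)) //=.
rewrite [in X in _ < X](bigD1 (Ordinal jz)) // [in X in _ < X](bigD1 (Ordinal lz)) //=.
rewrite !nth_mkseq // /swap_index eqxx (gtn_eqF jl) eqxx !addnA.
rewrite (eq_bigr (fun t : 'I__ => (size z - t) * (swap_at j l z)`_t)); last first.
  move=> t /andP[]; rewrite -!val_eqE /= => tj tl.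
  by rewrite nth_mkseq // /swap_index (negbTE tj) (negbTE tl).
rewrite ltn_add2r; move: (z`_j) (z`_l) lt => x y xy; nia.
Qed.

Lemma weight_le z : weight z <= size z * sumn z.
Proof.
rewrite sumnE (big_nth 0) big_mkord big_distrr /=.
by apply: leq_sum => t _; rewrite leq_mul2r leq_subr orbT.
Qed.

Definition improving_swap (m : nat) : relation (seq nat) := fun z z' =>
  [/\ admissible m z, admissible m z' &
    exists j l, [/\ j < l, l < size z, z`_j < z`_l & z' = swap_at j l z]].

Definition stuck (m : nat) (z : seq nat) : Prop := forall z', ~ improving_swap m z z'.

(** The induction is on the gap between the weight and its bound, which is the same for all
    rearrangements. *)
Lemma reach_stuck m z : admissible m z ->
  exists w, [/\ admissible m w, perm_eq w z, stuck m w &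
    clos_refl_trans _ (improving_swap m) z w].
Proof.
have [k] := ubnP (size z * sumn z - weight z).
elim: k z => // k IH z hk az.
have [[z' imp]|no] := classic (exists z', improving_swap m z z'); last first.
  by exists z; split=> //; [move=> z' h; apply: no; exists z'|apply: rt_refl].
have [_ az' [j [l [jl lz lt e]]]] := imp.
have p : perm_eq z' z by rewrite e perm_swap_at // (ltn_trans jl).
have wlt : weight z < weight z' by rewrite e weight_swap_at.
have wle := weight_le z'; rewrite (perm_size p) (perm_sumn p) in wle.
have [|w [aw pw sw rw]] := IH z' _ az'.
  rewrite (perm_size p) (perm_sumn p); rewrite ltnS in hk; apply: leq_trans hk.
  by apply: ltn_sub2l => //; apply: leq_trans wlt wle.
exists w; split=> //; first exact: perm_trans pw p.
by apply: rt_trans rw; apply: rt_step.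
Qed.

(* Either gate [t * m] is repeated or everything below it is forced. *)
Definition movable_gates (m : nat) (z : seq nat) : Prop :=
  forall t x, x \in z -> t * m < x ->
    1 < count_mem (t * m) z \/
    forall k, k < t * m -> count_mem k z <= 1 /\ (count_mem k z = 1 -> m %| k).

(** The induction runs over [l] from the right end, because both the admissibility of an exchange
    and a repeated gate refer to positions after [l]. *)
Lemma stuck_profile m z : 0 < m -> admissible m z -> stuck m z ->
  movable_gates m z -> forall l, l < size z ->
  forall j, j <= l -> if j * m < z`_l then z`_j = j * m else z`_l <= z`_j.
Proof.
move=> m0 az stk gz l lz.
have [k] := ubnP (size z - l); elim: k l lz => // k IHk l lz hk.
have {IHk hk}IH p : l < p -> p < size z ->
    forall j, j <= p -> if j * m < z`_p then z`_j = j * m else z`_p <= z`_j.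
  by move=> lp pz; apply: IHk => //; lia.
(* Otherwise exchanging positions [j.+1] and [l] would be improving; the hypothesis at [l.+1]
   ensures that the entry after [l] stays admissible. *)
have mono j : j.+1 < l -> z`_l <= step m z`_j -> z`_l <= z`_j.+1.
  move=> jl le; rewrite leqNgt; apply/negP => lt.
  apply: (stk (swap_at j.+1 l z)); split=> //; last by exists j.+1, l; split.
  apply: admissible_swap_at => //.
  move=> lz1; have := IH l.+1 (ltnSn l) lz1 j.+1 (leqW (ltnW jl)).
  case: ltnP => [h e|_ h]; last by apply: leq_trans h (ltnW (leq_step _ m0)).
  have := IH l.+1 (ltnSn l) lz1 j (leqW (ltnW (ltnW jl))).
  rewrite (leq_ltn_trans _ h) ?leq_mul2r ?leqnSn ?orbT // => e'.
  by move: le lt; rewrite e' e step_mul // => le /leq_trans/(_ le); rewrite ltnn.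
have [e|zl0] := posnP z`_l; first by move=> j _; rewrite e.
(* [c * m] is the largest gate strictly below the entry at [l]. *)
pose c := (z`_l).-1 %/ m.
have cl : c * m < z`_l by have := leq_trunc_div (z`_l).-1 m; rewrite /c; lia.
have lc : z`_l <= c.+1 * m by have := ltn_ceil (z`_l).-1 m0; rewrite /c; lia.
have ex : exists j, c * m <= z`_j by exists l; apply: ltnW.
(* The first entry to reach this gate must equal it. *)
case: (ex_minnP ex) => j0 cj0 minj0.
have lej0 j : j < j0 -> z`_j < c * m.
  by move=> jj; rewrite ltnNge; apply/negP => /minj0; rewrite leqNgt jj.
have ge_j0 j : c * m <= z`_j -> j0 <= j by apply: minj0.
have j0l : j0 <= l by apply: ge_j0; apply: ltnW.
have j0z := leq_ltn_trans j0l lz.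
have ej0 : z`_j0 = c * m.
  apply/anti_leq; rewrite cj0 andbT.
  case: (j0) j0z lej0 => [|j] jz lej; first by rewrite az.1.
  by apply: leq_trans (az.2 _ jz) _; rewrite step_le // lej.
have {}j0l : j0 < l.
  by rewrite ltn_neqAle j0l andbT; apply/eqP => e; move: cl; rewrite -e ej0 ltnn.
(* From [j0] on the entries are at least [c * m], so their steps reach the entry at [l] and [mono]
   propagates. *)
have after j : j0 < j -> j <= l -> z`_l <= z`_j.
  elim: j => // j IHj; rewrite ltnS => jj jl.
  move: (jl); rewrite leq_eqVlt => /orP[/eqP<-//|jl1].
  apply: mono => //; apply: leq_trans lc _; rewrite -step_mul //; apply: step_mono.
  move: jj; rewrite leq_eqVlt => /orP[/eqP<-//|jj].
  exact: leq_trans (ltnW cl) (IHj jj (ltnW jl)).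
have [ec pre] : j0 = c /\ forall j, j < c -> z`_j = j * m.
  have [|h] := gz c _ (mem_nth 0 lz) cl.
    (* By [after], a second occurrence of the gate lies beyond [l]; the induction hypothesis there
       fixes the first [c] entries. *)
    move=> /(count_mem_gt1_other 0 j0)[p [pz pj0 ep]].
    have lp : l < p.
      rewrite ltnNge; apply/negP => pl.
      have j0p : j0 < p by rewrite ltn_neqAle eq_sym pj0 ge_j0 // ep.
      by move: (after _ j0p pl); rewrite ep leqNgt cl.
    have Q := IH p lp pz; rewrite ep in Q.
    have pre j : j < c -> z`_j = j * m.
      move=> jc; have cp : c <= p by have := admissible_le m0 az pz; rewrite ep leq_pmul2r.
      by have := Q j (leq_trans (ltnW jc) cp); rewrite ltn_pmul2r // jc.
    split=> //; apply/anti_leq/andP; split.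
      apply: ge_j0; have cp : c <= p by have := admissible_le m0 az pz; rewrite ep leq_pmul2r.
      by have := Q c cp; rewrite ltnn.
    rewrite leqNgt; apply/negP => jc; move: ej0; rewrite pre // => /eqP.
    by rewrite eqn_pmul2r // ltn_eqF.
  (* The entries before [j0] are distinct multiples of [m], the one at [j] being at most [j * m]; by
     induction this leaves only [j * m]. *)
  have pre j : j < j0 -> z`_j = j * m.
    elim/ltn_ind: j => j IHj jj; have jz := ltn_trans jj j0z.
    have [c1 /(_ _)] := h _ (lej0 _ jj).
    have : 0 < count_mem z`_j z by rewrite -has_count has_pred1 mem_nth.
    case: (count_mem _ _) c1 => [|[|//]] // c1 _ /(_ erefl)/dvdnP[q eq].
    have := admissible_le m0 az jz; rewrite eq leq_pmul2r // leq_eqVlt => /orP[/eqP->//|qj].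
    have e := IHj q qj (ltn_trans qj jj).
    have [c2 _] := h _ (lej0 _ jj).
    have := count_mem_le1_inj c2 (ltn_trans qj jz) jz (x0 := 0).
    by rewrite e eq => /(_ erefl erefl) e'; rewrite e' ltnn in qj.
  have cj : c <= j0 by have := admissible_le m0 az j0z; rewrite ej0 leq_pmul2r.
  suff e : j0 = c by split=> // j jc; apply: pre; rewrite e.
  apply/anti_leq; rewrite cj andbT leqNgt; apply/negP => jc.
  by have := lej0 _ jc; rewrite pre // ltnn.
move=> j jl; case: ltnP => [jzl|zlj].
  have : j <= c by rewrite -ltnS -(ltn_pmul2r m0) (leq_trans jzl).
  by rewrite leq_eqVlt => /orP[/eqP->|/pre//]; rewrite -ec ej0 ec.
apply: after => //; rewrite ec -(ltn_pmul2r m0); exact: leq_trans cl zlj.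
Qed.

Lemma bigmax_mem s : s != [::] -> \max_(x <- s) x \in s.
Proof.
elim: s => // x s IH _; rewrite big_cons inE.
have [->|/IH{}IH] := eqVneq s [::]; first by rewrite big_nil maxn0 eqxx.
by case: (leqP x (\max_(y <- s) y)) => _; rewrite ?IH ?orbT ?eqxx.
Qed.

(** The profile at a position of the maximum puts the gates first, and at consecutive later
    positions it forces descents; the multiset then determines the sequence. *)
Lemma stuck_unique m z w : 0 < m -> admissible m z -> admissible m w ->
  stuck m z -> stuck m w -> movable_gates m z -> movable_gates m w ->
  perm_eq z w -> z = w.
Proof.
move=> m0 az aw sz sw gz gw p.
have [z0|zn] := eqVneq z [::]; first by move: p; rewrite z0 perm_sym => /perm_nilP ->.
pose M := \max_(x <- z) x; pose e := (M + m.-1) %/ m.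
have lte t : (t * m < M) = (t < e) by rewrite /e leq_divRL // mulSn; lia.
have canonical v : admissible m v -> stuck m v -> movable_gates m v -> perm_eq z v ->
    v = gates m e ++ drop e v /\ sorted geq (drop e v).
  move=> av sv gv pv; have Q := stuck_profile m0 av sv gv.
  have vM j : j < size v -> v`_j <= M.
    by move=> jv; apply: leq_bigmax_seq; rewrite // (perm_mem pv) mem_nth.
  have [l lv el] : exists2 l, l < size v & v`_l = M.
    by apply/nthP; rewrite -(perm_mem pv) bigmax_mem.
  have el' : e <= l.
    by rewrite leqNgt -lte -el -leqNgt; apply: admissible_le.
  have pre j : j < e -> v`_j = j * m.
    move=> je; have := Q l lv j (ltnW (leq_trans je el')).
    by rewrite el lte je.
  split.
    rewrite -{1}(cat_take_drop e v); congr (_ ++ _).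
    apply: (@eq_from_nth _ 0).
      by rewrite size_take (leq_ltn_trans el' lv) size_mkseq.
    move=> j; rewrite size_take (leq_ltn_trans el' lv) => je.
    by rewrite nth_take // nth_mkseq // pre.
  apply/(sortedP 0) => j; rewrite size_drop => jv.
  rewrite !nth_drop /=; have jv' : e + j.+1 < size v by lia.
  have := Q _ jv' (e + j); rewrite leq_add2l leqnSn => /(_ isT).
  (* Past [e] the product [j * m] is at least [M], so only the second branch of the profile
     remains. *)
  rewrite ifN // -leqNgt; apply: leq_trans (vM _ jv') _.
  by rewrite leqNgt lte -leqNgt leq_addr.
have [ez srz] := canonical z az sz gz (perm_refl z).
have [ew srw] := canonical w aw sw gw p.
rewrite ez ew; congr (_ ++ _); apply: (@sorted_eq _ geq).
- by move=> a b c ab bc; apply: leq_trans bc ab.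
- by move=> a b; rewrite andbC; apply: anti_leq.
- exact: srz.
- exact: srw.
by rewrite -(perm_cat2l (gates m e)) -ez -ew.
Qed.

(** * Boards and root vectors *)

Lemma singleton_stepE m x y : 0 < m -> singleton_step m x y =
  (x <= y) && ((x - floorm m x != 0) ==> (floorm m x < floorm m y)).
Proof.
move=> m0; rewrite /singleton_step /ceilm /floorm.
have rm := ltn_pmod x m0; have ex := divn_eq x m.
move: (x %/ m) (x %% m) rm ex => q r rm {x}->.
rewrite -addnA divnMDl // (addnC (q * m) r) addnK.
case: r rm => [|r] rm.
  by rewrite !add0n divn_small ?prednK // addn0 andbT.
rewrite (_ : r.+1 + m.-1 = 1 * m + r); last by lia.
rewrite divnMDl // divn_small ?(ltnW rm) // addn0 addn1 ltn_pmul2r // leq_divRL //.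
by rewrite /= mulSn; lia.
Qed.

Lemma board_singletonE m C : 0 < m ->
  board C && singleton m C = sorted (singleton_step m) C.
Proof.
move=> m0; apply/andP/(sortedP 0) => [[/(sortedP 0) bC /forallP sC] j jC|h].
  by rewrite singleton_stepE // bC //= (implyP (sC (Ordinal (ltnW jC)))).
split; first by apply/(sortedP 0) => j /h; rewrite singleton_stepE // => /andP[].
apply/forallP => j; apply/implyP => /h; rewrite singleton_stepE // => /andP[_ /=].
by [].
Qed.

(** Rounding [j * m - z] up to a multiple of [m] amounts to rounding [z] down, and one more [m]
    gives [step m z]. *)
Lemma singleton_step_sub m z y j : 0 < m -> z <= j * m -> y <= j.+1 * m ->
  singleton_step m (j * m - z) (j.+1 * m - y) = (y <= step m z).
Proof.
move=> m0 h1 h2; rewrite /singleton_step /ceilm /step.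
have zl := ltn_pmod z m0; have ze := divn_eq z m.
have le: z %/ m <= j by rewrite -(mulnK j m0); apply: leq_div2r.
move: (z %/ m) (z %% m) zl ze le => q r zl ze le.
have [k e] : exists k, j = k + q by exists (j - q); rewrite subnK.
move: h1 h2; rewrite {}e !mulSn !mulnDl => h1 h2.
have -> : k * m + q * m - z + m.-1 = k * m + (m.-1 - r) by lia.
by rewrite divnMDl // divn_small ?addn0; lia.
Qed.

(* An involution: it turns column heights into the root vector and back. *)
Definition compl (m : nat) (s : seq nat) : seq nat :=
  mkseq (fun j => j * m - s`_j) (size s).

Definition below_diagonal (m : nat) (s : seq nat) : Prop :=
  forall j, j < size s -> s`_j <= j * m.

Lemma size_compl m s : size (compl m s) = size s.
Proof. by rewrite size_mkseq. Qed.

Lemma nth_compl m s j : j < size s -> (compl m s)`_j = j * m - s`_j.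
Proof. by move=> js; rewrite nth_mkseq. Qed.

Lemma below_diagonal_compl m s : below_diagonal m (compl m s).
Proof. by move=> j; rewrite size_compl => js; rewrite nth_compl // leq_subr. Qed.

Lemma complK m s : below_diagonal m s -> compl m (compl m s) = s.
Proof.
move=> sd; apply: (@eq_from_nth _ 0); rewrite !size_compl // => j js.
by rewrite !nth_compl ?size_compl // subKn // sd.
Qed.

Lemma admissible_complP m s : 0 < m -> below_diagonal m s ->
  admissible m (compl m s) <-> sorted (singleton_step m) s.
Proof.
move=> m0 sd; have h j : j.+1 < size s ->
    singleton_step m s`_j s`_j.+1 = ((compl m s)`_j.+1 <= step m (compl m s)`_j).
  move=> js; have js' := ltnW js.
  rewrite -(@singleton_step_sub m _ _ j) ?nth_compl ?leq_subr //.
  by rewrite !subKn // sd.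
split=> [[_ a]|/(sortedP 0) srt].
  by apply/(sortedP 0) => j js; rewrite h // a // size_compl.
split=> [|j]; last by rewrite size_compl => js; rewrite -h // srt.
have [s0|s0] := posnP (size s); first by rewrite nth_default // size_compl s0.
by rewrite nth_compl.
Qed.

Lemma xi_compl m s : below_diagonal m s -> xi m s = [seq Posz z | z <- compl m s].
Proof.
move=> sd; rewrite /xi /compl /mkseq -map_comp; apply/eq_in_map => j.
by rewrite mem_iota => js; rewrite /= -subzn ?sd // mulnC.
Qed.

Lemma below_diagonalP m s :
  (forall z, z \in xi m s -> (0 <= z)%R) <-> below_diagonal m s.
Proof.
split=> [h j js|sd z]; last by rewrite xi_compl // => /mapP[x _ ->].
have : (Posz (m * j) - Posz s`_j)%R \in xi m s.
  by apply/mapP; exists j; rewrite // mem_iota.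
by move/h; lia.
Qed.

Lemma perm_xi_compl m s t : below_diagonal m s -> below_diagonal m t ->
  perm_eq (xi m s) (xi m t) = perm_eq (compl m s) (compl m t).
Proof.
move=> sd td; rewrite !xi_compl //; apply/idP/idP; last exact: perm_map.
by apply: perm_map_inj => a b [].
Qed.

(** * Padding and adjacency *)

Lemma size_pad N C : size C <= N -> size (pad N C) = N.
Proof. by move=> h; rewrite size_cat size_nseq subnK. Qed.

Lemma below_diagonal_nseq m p s : below_diagonal m s -> below_diagonal m (nseq p 0 ++ s).
Proof.
move=> sd j; rewrite size_cat size_nseq nth_cat size_nseq => jp.
case: ltnP => pj; first by rewrite nth_nseq pj.
by apply: leq_trans (sd _ _) _; rewrite ?leq_mul2r ?leq_subr ?orbT //; lia.
Qed.

Lemma filter_pad n C : normal_board C -> [seq x <- pad n C | 0 < x] = C.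
Proof.
case/andP=> _ pos; rewrite filter_cat (all_filterP pos).
by elim: (n - size C) => //= k.
Qed.

Lemma pad_filter s : sorted leq s -> pad (size s) [seq x <- s | 0 < x] = s.
Proof.
elim: s => //= x s IH ps; have {}IH := IH (path_sorted ps).
case: posnP => [->|x0].
  rewrite /pad subSn ?size_filter ?count_size //=.
  by rewrite /pad size_filter in IH; rewrite IH.
have pos : all (fun y => 0 < y) s.
  apply: sub_all (order_path_min leq_trans ps) => y; exact: leq_trans.
by rewrite (all_filterP pos) /pad /= subnn.
Qed.

(** The number of columns is left free here, so that all vertices can be compared at the width of
    [B]. *)
Definition adj_at (n : nat) (P1 P2 : seq nat) : Prop :=
  exists i j k, [/\ i < n, j < n, i != j, 0 < k &
    [/\ P1`_i = P2`_i + k, P2`_j = P1`_j + k &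
        forall l, l < n -> l != i -> l != j -> P1`_l = P2`_l]].

Lemma adj_sym C1 C2 : adj C1 C2 -> adj C2 C1.
Proof.
case=> i [j [k [iN jN ij k0 [e1 e2 e3]]]].
exists j, i, k; rewrite maxnC eq_sym; split=> //; split=> // l lN lj li.
by rewrite e3.
Qed.

Lemma pad_pad n N C : size C <= N -> N <= n -> pad n C = nseq (n - N) 0 ++ pad N C.
Proof. by move=> h1 h2; rewrite /pad catA -nseqD; congr (nseq _ _ ++ _); lia. Qed.

Lemma adj_padP n C1 C2 : size C1 <= n -> size C2 <= n ->
  adj C1 C2 <-> adj_at n (pad n C1) (pad n C2).
Proof.
move=> h1 h2; rewrite /adj; set N := maxn _ _.
have Nn : N <= n by rewrite geq_max h1.
rewrite (@pad_pad n N C1) ?leq_maxl // (@pad_pad n N C2) ?leq_maxr //.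
move: (pad N C1) (pad N C2) => P1 P2.
have lo (P : seq nat) l : l < n - N -> (nseq (n - N) 0 ++ P)`_l = 0.
  by move=> h; rewrite nth_cat size_nseq h nth_nseq h.
have hi (P : seq nat) l : n - N <= l -> (nseq (n - N) 0 ++ P)`_l = P`_(l - (n - N)).
  by move=> h; rewrite nth_cat size_nseq ltnNge h.
have hi' (P : seq nat) l : (nseq (n - N) 0 ++ P)`_(l + (n - N)) = P`_l.
  by rewrite hi ?leq_addl // addnK.
split=> -[i [j [k [iN jN ij k0 [e1 e2 e3]]]]].
  exists (i + (n - N)), (j + (n - N)), k; split=> //; try lia.
  split; rewrite ?hi' // => l ln li lj.
  have [l0|l0] := ltnP l (n - N); first by rewrite !lo.
  by rewrite !hi // e3; lia.
(* The added columns are empty in both boards, so the two differing columns lie to their right. *)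
have ni : n - N <= i by rewrite leqNgt; apply/negP => h; rewrite !lo in e1 => //; lia.
have nj : n - N <= j by rewrite leqNgt; apply/negP => h; rewrite !lo in e2 => //; lia.
rewrite !hi // in e1 e2.
exists (i - (n - N)), (j - (n - N)), k; split=> //; try lia.
split=> // l ln li lj; rewrite -(hi' P1) -(hi' P2) e3; lia.
Qed.

(** * Vertices as admissible rearrangements of the root vector *)

Section Vertices.
Variables (m : nat) (B : seq nat).
Hypotheses (m0 : 0 < m) (sB : sorted (singleton_step m) B) (dB : below_diagonal m B).

Definition roots (C : seq nat) : seq nat := compl m (pad (size B) C).

Definition board_of (z : seq nat) : seq nat := [seq x <- compl m z | 0 < x].

Lemma admissible_compl_board : admissible m (compl m B).
Proof. by apply/admissible_complP. Qed.

(** A wider vertex would share its roots with a padding of [B], so they would be non-negative; but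
    its first column is non-empty and gives a negative root. *)
Lemma vertex_size C : vertex m B C -> size C <= size B.
Proof.
case=> /andP[bC pC] [sC eC]; rewrite leqNgt; apply/negP => BC.
have gC : sorted (singleton_step m) C by rewrite -board_singletonE // bC.
have : perm_eq (xi m C) (xi m (pad (size C) B)).
  apply/rook_equiv_perm_xi; rewrite ?size_pad ?sorted_nseq_cat // 1?ltnW //.
  by move=> k; rewrite rook_pad.
move/perm_mem => e.
have /below_diagonalP/(_ 0) : forall z, z \in xi m C -> (0 <= z)%R.
  by move=> z; rewrite e; move: z; apply/below_diagonalP; apply: below_diagonal_nseq.
have C0 : 0 < size C by apply: leq_trans BC.
by move/(_ C0); rewrite leqNgt (allP pC) // mem_nth.
Qed.

Lemma vertex_roots C : vertex m B C ->
  [/\ below_diagonal m (pad (size B) C), admissible m (roots C) &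
      perm_eq (roots C) (compl m B)].
Proof.
move=> vC; have BC := vertex_size vC; case: vC => /andP[bC _] [sC eC].
have gC : sorted (singleton_step m) C by rewrite -board_singletonE // bC.
have gP : sorted (singleton_step m) (pad (size B) C) by rewrite sorted_nseq_cat.
have p : perm_eq (xi m (pad (size B) C)) (xi m B).
  apply/rook_equiv_perm_xi; rewrite ?size_pad // => k; rewrite rook_pad //.
have dC : below_diagonal m (pad (size B) C).
  by apply/below_diagonalP => z; rewrite (perm_mem p); move: z; apply/below_diagonalP.
by split=> //; [apply/admissible_complP|rewrite -perm_xi_compl].
Qed.

Lemma size_roots C : vertex m B C -> size (roots C) = size B.
Proof. by move=> vC; rewrite size_compl size_pad // vertex_size. Qed.

Lemma roots_inj C : vertex m B C -> board_of (roots C) = C.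
Proof.
by move=> vC; have [d _ _] := vertex_roots vC; rewrite /board_of complK // filter_pad // vC.1.
Qed.

Lemma pad_board_of z : admissible m z -> perm_eq z (compl m B) ->
  pad (size B) (board_of z) = compl m z.
Proof.
move=> az p; have sz : size z = size B by rewrite (perm_size p) size_compl.
rewrite -sz -(size_compl m z) pad_filter //.
have dz : below_diagonal m z by move=> j; apply: admissible_le.
have : sorted (singleton_step m) (compl m z).
  by apply/admissible_complP; rewrite ?complK //; apply: below_diagonal_compl.
by rewrite -board_singletonE // => /andP[].
Qed.

Lemma vertex_board_of z : admissible m z -> perm_eq z (compl m B) ->
  vertex m B (board_of z) /\ roots (board_of z) = z.
Proof.
move=> az p; have pb := pad_board_of az p.
have sz : size z = size B by rewrite (perm_size p) size_compl.
have dz : below_diagonal m z by move=> j; apply: admissible_le.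
have gz : sorted (singleton_step m) (compl m z).
  by apply/admissible_complP; rewrite ?complK //; apply: below_diagonal_compl.
have gb : sorted (singleton_step m) (board_of z).
  by rewrite -pb sorted_nseq_cat in gz.
split; last by rewrite /roots pb complK.
have := gb; rewrite -board_singletonE // => /andP[bb sb].
split; first by rewrite /normal_board bb /= filter_all.
split=> // k; rewrite -(rook_pad k (size B) m0 gb) pb; move: k.
apply/rook_equiv_perm_xi; rewrite ?size_compl //.
rewrite perm_xi_compl ?complK //; exact: below_diagonal_compl.
Qed.

(** A surplus of cells in a column is an equal deficit in the root vector, so an edge has the shape
    required by [index_unique_gate_edge]. *)
Lemma edge_roots_index t x C1 C2 :
  x \in compl m B -> t * m < x -> count_mem (t * m) (compl m B) = 1 ->
  G_edge m B C1 C2 -> index (t * m) (roots C1) = index (t * m) (roots C2).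
Proof.
move=> xB tx c1 [v1 v2].
have [d1 a1 p1] := vertex_roots v1; have [d2 a2 p2] := vertex_roots v2.
have s1 := vertex_size v1; have s2 := vertex_size v2.
move/(adj_padP s1 s2) => [i [j [k [iB jB ij k0 [e1 e2 e3]]]]].
have nth1 l : l < size B -> (roots C1)`_l = l * m - (pad (size B) C1)`_l.
  by move=> lB; rewrite nth_compl // size_pad.
have nth2 l : l < size B -> (roots C2)`_l = l * m - (pad (size B) C2)`_l.
  by move=> lB; rewrite nth_compl // size_pad.
have sz C : size C <= size B -> size (pad (size B) C) = size B by apply: size_pad.
have b1 := d1 i; have b2 := d2 j; rewrite !sz // in b1 b2.
apply: (@index_unique_gate_edge m t _ _ i j x x) => //.
- by rewrite !size_roots.
- by rewrite (permP p1).
- by rewrite (permP p2).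
- by rewrite (perm_mem p1).
- by rewrite (perm_mem p2).
- by rewrite nth1 // nth2 //; have := b1 iB; lia.
- by rewrite nth1 // nth2 //; have := b2 jB; lia.
- by move=> l; rewrite size_roots // => lB li lj; rewrite nth1 // nth2 // e3.
Qed.

Lemma swap_edge z z' : perm_eq z (compl m B) -> improving_swap m z z' ->
  perm_eq z' (compl m B) /\ G_edge m B (board_of z) (board_of z').
Proof.
move=> p [az az' [j [l [jl lz lt e]]]]; have jz := ltn_trans jl lz.
have p' : perm_eq z' (compl m B) by apply: perm_trans p; rewrite e perm_swap_at.
split=> //; have [v _] := vertex_board_of az p; have [v' _] := vertex_board_of az' p'.
split=> //; apply/(adj_padP (vertex_size v) (vertex_size v')).
rewrite !pad_board_of //.
have sz : size z = size B by rewrite (perm_size p) size_compl.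
have sz' : size z' = size z by rewrite e size_mkseq.
(* Admissibility of [z'] bounds its entry at [j], the old entry at [l], by [j * m], so the height of
   column [j] is not truncated. *)
have bj := admissible_le m0 az' (_ : j < size z'); rewrite sz' in bj.
have bl := admissible_le m0 az lz.
have nz' t : t < size z -> z'`_t = z`_(swap_index j l t) by move=> tz; rewrite e nth_mkseq.
rewrite /swap_index in nz'.
have ej : z'`_j = z`_l by rewrite nz' // eqxx.
have el : z'`_l = z`_j by rewrite nz' // (gtn_eqF jl) eqxx.
exists j, l, (z`_l - z`_j); rewrite -sz subn_gt0 (ltn_eqF jl); split=> //.
have {}bj := bj jz.
rewrite !nth_compl ?sz' // ej el; split; [move: bj; rewrite ej; lia|lia|].
move=> t tz tj tl; rewrite !nth_compl ?sz' // nz' // (negbTE tj) (negbTE tl) //.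
Qed.

Lemma improving_path z w : clos_refl_trans _ (improving_swap m) z w ->
  perm_eq z (compl m B) ->
  perm_eq w (compl m B) /\
  clos_refl_trans _ (G_edge m B) (board_of z) (board_of w).
Proof.
elim=> {z w} [z w h p|z p|x y z _ IH1 _ IH2 p].
- by have [pw e] := swap_edge p h; split=> //; apply: rt_step.
- by split=> //; apply: rt_refl.
- have [py e1] := IH1 p; have [pz e2] := IH2 py.
  by split=> //; apply: rt_trans e1 e2.
Qed.

Lemma path_sym C1 C2 : clos_refl_trans _ (G_edge m B) C1 C2 ->
  clos_refl_trans _ (G_edge m B) C2 C1.
Proof.
elim=> [x y [vx vy xy]|x|x y z _ h1 _ h2]; last exact: rt_trans h2 h1.
  by apply: rt_step; split=> //; apply: adj_sym.
exact: rt_refl.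
Qed.

(** Both vertices have paths to the same terminal arrangement, and one of the paths can be
    reversed. *)
Lemma connected_of_movable : movable_gates m (compl m B) -> G_connected m B.
Proof.
move=> mov C1 C2 v1 v2.
have [_ a1 p1] := vertex_roots v1; have [_ a2 p2] := vertex_roots v2.
have [w1 [aw1 pw1 st1 r1]] := reach_stuck a1.
have [w2 [aw2 pw2 st2 r2]] := reach_stuck a2.
have q1 := perm_trans pw1 p1; have q2 := perm_trans pw2 p2.
have mvb w : perm_eq w (compl m B) -> movable_gates m w.
  move=> p t x; rewrite (perm_mem p) => xB tx; have := mov t x xB tx.
  rewrite !(permP p) => -[|h]; [by left|right=> k]; rewrite !(permP p); exact: h.
have e : w1 = w2.
  apply: (@stuck_unique m) => //; [exact: mvb|exact: mvb|].
  by apply: perm_trans q1 _; rewrite perm_sym.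
have [_ g1] := improving_path r1 p1; have [_ g2] := improving_path r2 p2.
rewrite !roots_inj // in g1 g2; rewrite e in g1.
exact: rt_trans g1 (path_sym g2).
Qed.

(** The position of an unrepeated gate is constant along edges. Connectedness then puts it at [t] in
    the increasing arrangement too, which leaves no room for the extra value [i] before it. *)
Lemma gate_repeated_of_connected i t x : G_connected m B ->
  1 < count_mem i (compl m B) \/ (count_mem i (compl m B) = 1 /\ ~~ (m %| i)) ->
  i < t * m -> x \in compl m B -> t * m < x -> 1 < count_mem (t * m) (compl m B).
Proof.
move=> conn hi it xB tx; set Z := compl m B in hi xB *.
have aZ : admissible m Z := admissible_compl_board.
have memZ u : u <= t -> u * m \in Z.
  by move=> ut; apply: (admissible_mem m0 aZ xB); apply: leq_ltn_trans tx; rewrite leq_mul2r ut orbT.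
have : 0 < count_mem (t * m) Z by rewrite -has_count has_pred1 memZ.
rewrite leq_eqVlt => /orP[/eqP/esym c1|//].
have [w [aw pw] iw] := admissible_gates_first m0 aZ.
have as_ := admissible_sort m0 aZ; set s := sort leq Z in as_.
have ps : perm_eq s Z by rewrite perm_sort.
have [v1 r1] := vertex_board_of as_ ps; have [v2 r2] := vertex_board_of aw pw.
have inv C1 C2 : clos_refl_trans _ (G_edge m B) C1 C2 ->
    index (t * m) (roots C1) = index (t * m) (roots C2).
  elim=> // [C C'|x1 x2 x3 _ -> _ ->//]; exact: edge_roots_index xB tx c1.
have := inv _ _ (conn _ _ v1 v2); rewrite r1 r2 (iw _ _ xB tx) => et.
have srt : sorted leq s := sort_sorted leq_total Z.
have ts : t < size s by rewrite -et index_mem (perm_mem ps) memZ.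
have est : s`_t = t * m.
  by have := @nth_index _ 0 (t * m) s; rewrite et; apply; rewrite (perm_mem ps) memZ.
(* Values below the gate occur only among the first [t] sorted entries. *)
have hd y : y \in drop t s -> t * m <= y.
  move=> /(nthP 0)[u]; rewrite size_drop nth_drop => us <-; rewrite -est.
  by apply: nondecreasing_nth srt _ _; rewrite ?leq_addr -?ltn_subRL.
have cnt y : y < t * m -> count_mem y Z = count_mem y (take t s).
  move=> yt; rewrite -(permP ps) -{1}(cat_take_drop t s) count_cat.
  rewrite [X in _ + X](count_memPn _) ?addn0 //.
  by apply/negP => /hd; rewrite leqNgt yt.
have ug : uniq (gates m t).
  rewrite map_inj_uniq ?iota_uniq // => a b /eqP.
  by rewrite eqn_pmul2r // => /eqP.
have sub : {subset gates m t <= take t s}.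
  move=> y /mapP[u]; rewrite mem_iota add0n => /= ut ->.
  by rewrite -has_pred1 has_count -cnt ?ltn_pmul2r // -has_count has_pred1 memZ // ltnW.
have szt : size (take t s) <= size (gates m t) by rewrite size_mkseq size_take ts.
(* The [t] smaller gates are distinct and fill these [t] places, so nothing else occurs there and
   nothing twice. *)
have [_ eqm] := uniq_min_size ug sub szt.
have ut := leq_size_uniq ug sub szt.
have ci := cnt i it; rewrite (count_uniq_mem _ ut) -eqm in ci.
case: hi; rewrite ci; first by case: (i \in _).
case: (boolP (i \in gates m t)) => [/mapP[u _ ->]|_]; last by case.
by rewrite dvdn_mull // => -[].
Qed.

End Vertices.

(** * The criterion in terms of the multiplicities of the roots *)

Theorem theorem21 (m : nat) (B : seq nat) :
  0 < m -> 0 < size B -> board B -> singleton m B ->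
  (forall z, z \in xi m B -> (0 <= z)%R) ->
  (G_connected m B <->
   (forall i : nat, Pi m B i -> (forall j, j < i -> ~ Pi m B j) ->
      forall s : nat, m %| s -> s < Mmax m B -> i < s -> 2 <= vcount m B s)).
Proof.
move=> m0 _ bB sgB /below_diagonalP dB.
have sB : sorted (singleton_step m) B by rewrite -board_singletonE // bB.
have vE k : vcount m B k = count_mem k (compl m B).
  by rewrite /vcount xi_compl // count_map; apply: eq_count.
have ME : Mmax m B = \max_(z <- compl m B) z by rewrite /Mmax xi_compl // big_map.
split=> [conn i Pi_i _ s /dvdnP[t ->] sM it|cond].
  have Zn : compl m B != [::].
    by apply/eqP => e; rewrite ME e big_nil in sM.
  rewrite ME in sM; rewrite vE.
  (* The maximum itself serves as the entry above the gate. *)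
  apply: (gate_repeated_of_connected m0 sB dB conn _ it (bigmax_mem Zn) sM).
  by rewrite /Pi !vE in Pi_i.
apply: connected_of_movable => // t x xB tx.
have tM : t * m < Mmax m B by rewrite ME; apply: leq_trans tx (leq_bigmax_seq _ xB _).
pose P k := (1 < vcount m B k) || ((vcount m B k == 1) && ~~ (m %| k)).
have PP k : reflect (Pi m B k) (P k).
  apply: (iffP orP) => -[h|]; [by left| |by left|].
    by move=> /andP[/eqP h1 h2]; right.
  by move=> [h1 h2]; right; rewrite h1 h2.
(* If something extra lies below the gate, the least such value does too, and the condition makes
   the gate repeated; otherwise everything below the gate is forced. *)
have [[k /andP[kt Pk]]|no] := classic (exists k, (k < t * m) && P k).
  left; rewrite -vE; have ex : exists k, P k by exists k.
  case: (ex_minnP ex) => i /PP Pi_i mini.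
  apply: (cond i) => //; last exact: leq_ltn_trans (mini _ Pk) kt.
    by move=> j ji /PP/mini; rewrite leqNgt ji.
  by rewrite dvdn_mull.
right=> k kt; have : ~~ P k by apply/negP => Pk; apply: no; exists k; rewrite kt.
rewrite negb_or -leqNgt vE => /andP[h1 h2]; split=> // e1.
by move: h2; rewrite e1 negbK.
Qed.
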